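(* Let $G$ be a matroid on $[n]$ with no loops and no multiple points, and let $\preceq$ be a partial order on $[n]$. For any linear order on $[n]$ extending $\preceq$, the set $\operatorname{nbc}(G)$ of nbc sets with respect to that linear order is contained in $\operatorname{NBB}(G,\preceq)$.
   Context: Given a linear order on $[n]$, a broken circuit is $C-\min(C)$ for a circuit $C$ of $G$, and an nbc set is a subset containing no broken circuit. $S$ is line-closed if $\operatorname{cl}(\{i,j\})\subseteq S$ for all $i,j\in S$ ($\operatorname{cl}$ = matroid closure); $\operatorname{lc}(S)$ is the intersection of the line-closed sets containing $S$; $\bar{L}(G)$ is the lattice of line-closed sets with join $\operatorname{lc}(X\cup Y)$ and atoms the singletons, identified with $[n]$. A set $T\subseteq[n]$ is bounded below (w.r.t. $\preceq$) if there is an atom $a$ with $\{a\}<\operatorname{lc}(T)$ and $a\prec t$ for all $t\in T$; $\operatorname{NBB}(G,\preceq)$ is the collection of subsets of $[n]$ containing no bounded-below subset. *)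

(* Defs.v *)
From mathcomp Require Import all_boot.

Set Implicit Arguments.
Unset Strict Implicit.
Unset Printing Implicit Defensive.

Record matroid (E : finType) := Matroid {
  indep : {set {set E}};
  indep0 : set0 \in indep;
  indepS : forall A B : {set E}, A \subset B -> B \in indep -> A \in indep;
  indep_aug : forall A B : {set E}, A \in indep -> B \in indep ->
    #|A| < #|B| -> exists2 x, x \in B :\: A & x |: A \in indep
}.

Section MatroidNotions.
Variables (E : finType) (G : matroid E).
Implicit Types (A B C S T : {set E}) (x y a : E).

Definition circuit C : bool := minset (fun D : {set E} => D \notin indep G) C.

Definition mrank A : nat := \max_(I in indep G | I \subset A) #|I|.

Definition mclosure A : {set E} := [set x | mrank (x |: A) == mrank A].

Definition loop x : bool := circuit [set x].

Definition parallel x y : bool := (x != y) && circuit [set x; y].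

Definition simple_matroid : Prop :=
  (forall x, ~~ loop x) /\ (forall x y, ~~ parallel x y).

Definition line_closed S : bool :=
  [forall i in S, forall j in S, mclosure [set i; j] \subset S].

Definition lc S : {set E} := \bigcap_(X : {set E} | line_closed X && (S \subset X)) X.

Definition is_min (le : rel E) C c : bool :=
  (c \in C) && [forall d in C, le c d].

Definition broken_circuit (le : rel E) B : bool :=
  [exists C : {set E}, exists c : E,
     [&& circuit C, is_min le C c & B == C :\ c]].

Definition nbc (le : rel E) : {set {set E}} :=
  [set S : {set E} | [forall B : {set E}, broken_circuit le B ==> ~~ (B \subset S)]].

(* The lattice of line-closed sets is ordered by inclusion, so {a} < lc(T) is
   strict inclusion.  As lc(set0) = set0, the empty set is never bounded below. *)
Definition bounded_below (le : rel E) T : bool :=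
  [exists a : E, ([set a] \proper lc T) &&
                 [forall t in T, (a != t) && le a t]].

Definition NBB (le : rel E) : {set {set E}} :=
  [set S : {set E} | [forall T : {set E}, bounded_below le T ==> ~~ (T \subset S)]].

End MatroidNotions.

Definition partial_order (E : Type) (le : rel E) : Prop :=
  [/\ reflexive le, antisymmetric le & transitive le].

Definition linear_order (E : Type) (le : rel E) : Prop :=
  partial_order le /\ total le.

(* Main.v *)
(* If a lies in lc(T) then a lies in the matroid closure of T, since flats are
   line-closed.  As a is not in T, the set T + a is dependent and contains a
   circuit C.  Since a precedes all of T, removing the least element of C leaves
   a broken circuit inside T, so T is not contained in any nbc set. *)

Require Import Defs.
From mathcomp Require Import all_boot.

Set Implicit Arguments.
Unset Strict Implicit.
Unset Printing Implicit Defensive.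

Section Rank.
Variables (E : finType) (G : matroid E).
Implicit Types (A B I S T : {set E}) (x y : E).

Lemma mrank_ge A I : I \in indep G -> I \subset A -> #|I| <= mrank G A.
Proof.
move=> indI sIA; rewrite /mrank.
by apply: (@leq_bigmax_cond _ _ (fun I : {set E} => #|I|)); rewrite indI sIA.
Qed.

Lemma mrank_basis A :
  exists I, [/\ I \in indep G, I \subset A & #|I| = mrank G A].
Proof.
have P0 : (set0 \in indep G) && (set0 \subset A) by rewrite indep0 sub0set.
have [|I /andP[indI sIA] eqI] := @eq_bigmax_cond _
    (fun I : {set E} => (I \in indep G) && (I \subset A)) (fun I => #|I|).
  by apply/card_gt0P; exists set0.
by exists I; split.
Qed.

Lemma mrank_le_card A : mrank G A <= #|A|.
Proof. by have [I [_ sIA <-]] := mrank_basis A; apply: subset_leq_card. Qed.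

Lemma mrankS A B : A \subset B -> mrank G A <= mrank G B.
Proof.
have [I [indI sIA <-]] := mrank_basis A => sAB.
by apply: mrank_ge => //; apply: subset_trans sAB.
Qed.

(** Take [J] maximal among the independent sets between [I] and [A]; were it smaller than a basis
    [K] of [A], augmentation from [K] would enlarge it within [A]. *)
Lemma indep_extend A I : I \in indep G -> I \subset A ->
  exists J, [/\ J \in indep G, I \subset J, J \subset A & #|J| = mrank G A].
Proof.
move=> indI sIA.
have PI : [&& I \in indep G, I \subset I & I \subset A] by rewrite indI subxx sIA.
have [J /maxsetP[/and3P[indJ sIJ sJA] maxJ] _] := @maxset_exists _
  (fun J : {set E} => [&& J \in indep G, I \subset J & J \subset A]) I PI.
exists J; split=> //; apply/eqP; rewrite eqn_leq mrank_ge //= leqNgt.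
have [K [indK sKA <-]] := mrank_basis A.
apply/negP => ltJK; have [x /setDP[Kx notJx] indxJ] := indep_aug indJ indK ltJK.
(* Maximality forces [x |: J] to equal [J], which puts [x] in [J]. *)
move/negP: notJx; apply; rewrite -(maxJ (x |: J)) ?setU11 ?subsetUr //.
rewrite indxJ (subset_trans sIJ (subsetUr _ _)) /=.
by rewrite subUset sub1set (subsetP sKA) // sJA.
Qed.

(** Extend a basis [I] of [A] to a basis [J] of [B]. If [x] raised the rank of [B], then [x |: J]
    would be independent, hence so would [x |: I], and [x] would raise the rank of [A] too. *)
Lemma mclosureS A B : A \subset B -> mclosure G A \subset mclosure G B.
Proof.
move=> sAB; apply/subsetP => x; rewrite !inE => /eqP rxA.
rewrite eqn_leq (mrankS (subsetUr _ _)) andbT leqNgt; apply/negP => ltB.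
have [I [indI sIA cardI]] := mrank_basis A.
have [J [indJ sIJ sJB cardJ]] := indep_extend indI (subset_trans sIA sAB).
have [K [indK sKxB cardK]] := mrank_basis (x |: B).
have ltJK : #|J| < #|K| by rewrite cardJ cardK.
have [y /setDP[Ky notJy] indyJ] := indep_aug indJ indK ltJK.
(* The augmenting element must be [x]: one from [B] would give an independent subset of [B] larger
   than its rank. *)
have := subsetP sKxB y Ky; case/setU1P => [eqyx | By]; last first.
  have : #|y |: J| <= mrank G B.
    by apply: mrank_ge; rewrite // subUset sub1set By.
  by rewrite cardsU1 notJy cardJ ltnn.
rewrite {}eqyx in notJy indyJ.
have : #|x |: I| <= mrank G (x |: A).
  by apply: mrank_ge; [apply: indepS indyJ; apply: setUS | apply: setUS].
by rewrite cardsU1 (contra (subsetP sIJ x) notJy) cardI rxA ltnn.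
Qed.

Lemma sub_mclosure A : A \subset mclosure G A.
Proof.
by apply/subsetP => x Ax; rewrite inE (setUidPr _) // sub1set.
Qed.

(** Adding [i], then [j], then [k] to [A] never changes the rank: by monotonicity each new element
    stays in the closure of the set enlarged so far. *)
Lemma mclosure_line_closed A : line_closed G (mclosure G A).
Proof.
apply/forall_inP => i clAi; apply/forall_inP => j clAj.
apply/subsetP => k clk; rewrite inE eqn_leq (mrankS (subsetUr _ _)) andbT.
have clj : j \in mclosure G (i |: A) := subsetP (mclosureS (subsetUr _ _)) j clAj.
have sijA : [set i; j] \subset j |: (i |: A).
  by rewrite setUCA setUA subsetUl.
have {}clk := subsetP (mclosureS sijA) k clk.
(* The three equalities turn the rank of [A] into that of [k |: (j |: (i |: A))], which contains
   [k |: A]. *)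
move: clAi clj clk; rewrite !inE => /eqP <- /eqP <- /eqP <-.
by apply/mrankS/setUS; rewrite setUA subsetUr.
Qed.

Lemma lc_sub_mclosure T : lc G T \subset mclosure G T.
Proof. by apply: bigcap_inf; rewrite mclosure_line_closed sub_mclosure. Qed.

Lemma dependent_circuit A : A \notin indep G ->
  exists2 C, circuit G C & C \subset A.
Proof.
by move=> depA; have [C] := @minset_exists _ (fun D => D \notin indep G) A depA; exists C.
Qed.

Lemma circuit_neq0 C : circuit G C -> C != set0.
Proof. by case/minsetP => depC _; apply: contraNneq depC => ->; apply: indep0. Qed.

End Rank.

Lemma linear_order_min (E : finType) (le : rel E) (C : {set E}) :
  linear_order le -> C != set0 -> exists c, is_min le C c.
Proof.
move=> [[le_refl _ le_trans] le_total] /set0Pn[x Cx].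
have [c Cc minc] := @extremumP E E le x [in C] id le_refl le_trans le_total Cx.
by exists c; apply/andP; split=> //; apply/forall_inP.
Qed.

Lemma bounded_below_broken_circuit (E : finType) (G : matroid E) (ple lin : rel E)
    (T : {set E}) :
  linear_order lin -> subrel ple lin -> bounded_below G ple T ->
  exists2 B, broken_circuit G lin B & B \subset T.
Proof.
move=> hlin hext /existsP[a /andP[/proper_sub + /forall_inP ltaT]].
rewrite sub1set => /(subsetP (lc_sub_mclosure G T)); rewrite inE => /eqP raT.
have notTa : a \notin T by apply/negP => /ltaT; rewrite eqxx.
have /dependent_circuit[C circC sCaT] : a |: T \notin indep G.
  (* Otherwise [a |: T] would have rank [#|T| + 1], but its rank is that of [T], at most [#|T|]. *)
  apply/negP => indaT; have := mrank_ge indaT (subxx _).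
  by rewrite cardsU1 notTa raT leqNgt add1n ltnS mrank_le_card.
have [c minc] := linear_order_min hlin (circuit_neq0 circC).
exists (C :\ c).
  by apply/existsP; exists C; apply/existsP; exists c; rewrite circC minc eqxx.
case/andP: minc => Cc /forall_inP minc.
(* Only [a] could lie in [C :\ c] but outside [T]. Then [c], being different from [a], is in [T], so
   [a] and [c] precede each other in [lin] and antisymmetry gives a contradiction. *)
apply/subsetP => x /setD1P[neqxc Cx].
case/setU1P: (subsetP sCaT x Cx) => // eqxa; rewrite {}eqxa in neqxc Cx.
case/setU1P: (subsetP sCaT c Cc) => [eqca | Tc]; first by rewrite eqca eqxx in neqxc.
have /andP[_ /hext leac] := ltaT c Tc.
have [[_ le_anti _] _] := hlin.
by case/eqP: neqxc; apply: le_anti; rewrite leac minc.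
Qed.

Theorem theorem2p31 (n : nat) (G : matroid 'I_n) (ple lin : rel 'I_n)
  (hG : simple_matroid G)
  (hple : partial_order ple)
  (hlin : linear_order lin)
  (hext : subrel ple lin) :
  nbc G lin \subset NBB G ple.
Proof.
apply/subsetP => S; rewrite !inE => /forall_inP nbcS.
apply/forall_inP => T /(bounded_below_broken_circuit hlin hext)[B brokenB sBT].
(* If [T] were inside [S], so would be the broken circuit [B]. *)
by apply: contra (nbcS B brokenB); apply: subset_trans.
Qed.
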